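(* There is a universal constant $C>0$ such that the following holds. Let $d,n\ge 1$ be integers, let $\epsilon\in(0,1]$ and $\delta\in(0,1)$, and let $S=\{\rho_1,\dots,\rho_n\}$ be a set of $n$ distinct mixed states on $\mathbb{C}^d$ such that $F(\rho_i,\rho_j)\le 1-\epsilon$ for all $i\ne j$. Put $k=\lceil C\log(n/\delta)/\epsilon\rceil$, and let $\mu_1,\dots,\mu_n$ be the pretty good measurement of the family $\rho_1^{\otimes k},\dots,\rho_n^{\otimes k}$ of states on $(\mathbb{C}^d)^{\otimes k}$. Then $$\max_{1\le i\le n}\left(1-\operatorname{tr}(\mu_i\,\rho_i^{\otimes k})\right)\le\delta .$$ That is, the worst-case state discrimination problem for $S$ can be solved with failure probability $\delta$ by applying the pretty good measurement to $O(\log(n/\delta)/\epsilon)$ copies of the unknown state.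
   Context: A mixed state on a finite-dimensional complex Hilbert space is a positive semidefinite operator of trace 1. The fidelity is $F(\rho,\sigma)=\|\sqrt{\rho}\sqrt{\sigma}\|_1$, where $\|\cdot\|_1$ is the trace norm. Worst-case state discrimination problem: given (copies of) an unknown state $\rho$ from a known set $S=\{\rho_1,\dots,\rho_n\}$, identify $\rho$. A measurement on $k$ copies is a POVM, i.e. positive semidefinite operators $\mu_1,\dots,\mu_n$ summing to the identity; outcome $i$ occurs on input $\rho_j^{\otimes k}$ with probability $\operatorname{tr}(\mu_i\rho_j^{\otimes k})$. It solves the problem with failure probability $\delta$ if $\max_i (1-\operatorname{tr}(\mu_i\rho_i^{\otimes k}))\le\delta$. The pretty good measurement (PGM) of a finite family of states $\sigma_1,\dots,\sigma_n$ (no prior probabilities are used) has operators $\mu_i=\Sigma^{-1/2}\sigma_i\Sigma^{-1/2}$, where $\Sigma=\sum_i\sigma_i$ and the inverse is taken on the support of $\Sigma$ (and is zero on its orthogonal complement). The $\mu_i$ sum to the identity on the support of $\Sigma$, on which all the $\sigma_i$ are supported. *)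

(* Defs.v *)
From HB Require Import structures.
From mathcomp Require Import all_boot all_order all_algebra.
From mathcomp Require Import spectral complex.
From mathcomp Require mxtens.
From mathcomp Require Import reals exp.

Set Implicit Arguments.
Unset Strict Implicit.
Unset Printing Implicit Defensive.

Import Order.TTheory GRing.Theory Num.Theory.
Local Open Scope ring_scope.
Local Open Scope sesquilinear_scope.
Local Open Scope complex_scope.

Definition psdmx (R : realType) (m : nat) (A : 'M[R[i]]_m) : Prop :=
  A \is hermsymmx /\ forall v : 'cV[R[i]]_m, 0 <= (v ^t* *m A *m v) 0 0.

Definition mixed_state (R : realType) (m : nat) (A : 'M[R[i]]_m) : Prop :=
  psdmx A /\ \tr A = 1.

(* Functional calculus: for normal A, with spectral decomposition
   A = U^-1 D U, this is f(A) = U^-1 f(D) U, which does not depend on the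
   decomposition chosen by the library. *)
Definition mxfun (R : realType) (m : nat) (f : R[i] -> R[i])
    (A : 'M[R[i]]_m) : 'M[R[i]]_m :=
  invmx (spectralmx A) *m diag_mx (map_mx f (spectral_diag A)) *m spectralmx A.

Definition sqrtmx (R : realType) (m : nat) (A : 'M[R[i]]_m) : 'M[R[i]]_m :=
  mxfun sqrtC A.

(* A^(-1/2) on the support of a positive semidefinite A, and zero on its
   orthogonal complement, because 0^-1 = 0. *)
Definition invsqrtmx (R : realType) (m : nat) (A : 'M[R[i]]_m) : 'M[R[i]]_m :=
  mxfun (fun x => (sqrtC x)^-1) A.

(* Here, as in outcome_prob, the trace is a real number (on the intended
   arguments), and [complex.Re] only moves it from R[i] to R. *)
Definition trace_norm (R : realType) (m : nat) (A : 'M[R[i]]_m) : R :=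
  complex.Re (\tr (sqrtmx (A ^t* *m A))).

Definition fidelity (R : realType) (m : nat) (A B : 'M[R[i]]_m) : R :=
  trace_norm (sqrtmx A *m sqrtmx B).

(* The k-th tensor (Kronecker) power, acting on (C^d)^(x)k = C^(d^k). *)
Definition tensor_power (R : realType) (d : nat) (A : 'M[R[i]]_d) (k : nat) :
    'M[R[i]]_(d ^ k) :=
  mxtens.ntensmx A k.

Definition pgm (R : realType) (m n : nat) (sigma : 'I_n -> 'M[R[i]]_m)
    (i : 'I_n) : 'M[R[i]]_m :=
  let T := invsqrtmx (\sum_(j < n) sigma j) in T *m sigma i *m T.

Definition outcome_prob (R : realType) (m : nat) (mu sigma : 'M[R[i]]_m) : R :=
  complex.Re (\tr (mu *m sigma)).

(* The default value 0 of the maximum is harmless: for positive semidefinite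
   mu i with sum at most the identity and for states sigma i, every term is
   nonnegative. *)
Definition worst_case_failure (R : realType) (m n : nat)
    (mu sigma : 'I_n -> 'M[R[i]]_m) : R :=
  \big[Num.max/0]_(i < n) (1 - outcome_prob (mu i) (sigma i)).

(* Main.v *)
Require Import Defs.
From HB Require Import structures.
From mathcomp Require Import all_boot all_order all_algebra.
From mathcomp Require Import sesquilinear spectral complex.
From mathcomp Require mxtens.
From mathcomp Require Import reals sequences exp.

(** Write [S] for the sum of the states [s_j], [T = S^(-1/2)],
    [a_j = s_j^(1/2)], and [Y'] for the adjoint of [Y].  The blocks [a_i T a_j]
    form the square root of the Gram matrix with blocks [a_i a_j], and
    [1 - tr (mu_i s_i) = tr N] with [N = sum_(j <> i) (a_i T a_j) (a_i T a_j)'].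
    Splitting the indices into [{i}] and the rest, let [[X, Y], [Y', Z]] be the
    square root: the off-diagonal block of the Gram matrix is [X Y + Y Z], and
    pairing it with the polar part [Y' (Y Y')^(-1/2)] of [Y'] gives at least
    [2 tr (Y Y')] by positivity, and at most the sum of the trace norms of the
    blocks [a_i a_j] by duality.  Hence the failure probability on [s_i] is at
    most [1/2 sum_(j <> i) F(s_i, s_j)].  The fidelity is multiplicative under
    tensor powers, so on [k] copies this is at most
    [n (1 - eps)^k <= n exp(- eps k)], and [C = 1] works. *)

Set Implicit Arguments.
Unset Strict Implicit.
Unset Printing Implicit Defensive.

Import Order.TTheory GRing.Theory Num.Theory.
Local Open Scope ring_scope.
Local Open Scope sesquilinear_scope.

(** * Positive semidefinite matrices *)

(* The definitions of Defs are restated over an abstract field: unification over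
   the concrete type R[i] is prohibitively slow. *)
Section PositiveMatrices.
Variable C : numClosedFieldType.

Lemma adjmxM m n p (A : 'M[C]_(m, n)) (B : 'M[C]_(n, p)) :
  (A *m B)^t* = B^t* *m A^t*.
Proof. by rewrite trmx_mul map_mxM. Qed.

Lemma adjmxB m n (A B : 'M[C]_(m, n)) : (A - B)^t* = A^t* - B^t*.
Proof. by rewrite linearB /= map_mxB. Qed.

Lemma adjmx1 n : (1%:M : 'M[C]_n)^t* = 1%:M.
Proof. by rewrite trmx1 map_mx1. Qed.

Lemma mxtrace_adj n (A : 'M[C]_n) : \tr (A^t*) = (\tr A)^*%R.
Proof. by rewrite /mxtrace rmorph_sum; apply: eq_bigr => i _; rewrite !mxE. Qed.

Lemma mxtraceB n (A B : 'M[C]_n) : \tr (A - B) = \tr A - \tr B.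
Proof. exact: raddfB. Qed.

(** * The squared Frobenius norm *)

Definition sqfrob m n (Z : 'M[C]_(m, n)) : C := \tr (Z^t* *m Z).

Lemma sqfrobE m n (Z : 'M[C]_(m, n)) : sqfrob Z = \sum_j \sum_i `|Z i j| ^+ 2.
Proof.
rewrite /sqfrob /mxtrace; apply: eq_bigr => j _; rewrite !mxE.
by apply: eq_bigr => i _; rewrite !mxE mulrC -normCK.
Qed.

Lemma sqfrob_ge0 m n (Z : 'M[C]_(m, n)) : 0 <= sqfrob Z.
Proof. by rewrite sqfrobE; do 2!apply: sumr_ge0 => ? _; rewrite exprn_ge0. Qed.

Lemma sqfrob_eq0 m n (Z : 'M[C]_(m, n)) : sqfrob Z = 0 -> Z = 0.
Proof.
have H (i : 'I_m) (j : 'I_n) : 0 <= `|Z i j| ^+ 2 by rewrite exprn_ge0.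
rewrite sqfrobE => /psumr_eq0P Z0; apply/matrixP => i j; rewrite mxE.
have /psumr_eq0P := Z0 (fun j _ => sumr_ge0 _ (fun i _ => H i j)) j isT.
move=> /(_ (fun i _ => H i j) i isT) /eqP.
by rewrite sqrf_eq0 normr_eq0 => /eqP.
Qed.

(** Expansion of [0 <= sqfrob (p - q)]. Both the duality bound for the trace norm and the positivity
    step for the measurement rest on it. *)
Lemma sqfrob_amgm m n (p q : 'M[C]_(m, n)) :
  \tr (p^t* *m q) + (\tr (p^t* *m q))^*%R <= sqfrob p + sqfrob q.
Proof.
rewrite -mxtrace_adj adjmxM trmxCK -subr_ge0.
have := sqfrob_ge0 (p - q); congr (0 <= _).
rewrite /sqfrob adjmxB mulmxBl !mulmxBr !mxtraceB.
by rewrite opprB addrACA -opprD.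
Qed.

Implicit Types (f g : C -> C).

(** * Positivity, functional calculus and square roots *)

Definition psd n (A : 'M[C]_n) : Prop :=
  A \is hermsymmx /\ forall v : 'cV[C]_n, 0 <= (v ^t* *m A *m v) 0 0.

(* Locked, so that rewriting with associativity does not expand it. *)
Fact fcalc_key : unit. Proof. by []. Qed.

Definition fcalc n f (A : 'M[C]_n) : 'M[C]_n :=
  locked_with fcalc_key
    (invmx (spectralmx A) *m diag_mx (map_mx f (spectral_diag A))
       *m spectralmx A).

Lemma fcalcE n f (A : 'M[C]_n) : fcalc f A =
  invmx (spectralmx A) *m diag_mx (map_mx f (spectral_diag A)) *m spectralmx A.
Proof. by rewrite /fcalc unlock. Qed.

Definition psdroot n (A : 'M[C]_n) := fcalc sqrtC A.

Lemma psd_adj n (A : 'M[C]_n) : psd A -> A^t* = A.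
Proof. by case=> /is_hermitianmxP + _; rewrite expr0 scale1r => <-. Qed.

Lemma psd_gram m n (B : 'M[C]_(m, n)) : psd (B^t* *m B).
Proof.
split=> [|v].
  by apply/is_hermitianmxP; rewrite expr0 scale1r adjmxM trmxCK.
rewrite mulmxA -mulmxA -adjmxM -[X in 0 <= X]trace_mx11; exact: sqfrob_ge0.
Qed.

Lemma psd_sum n I (r : seq I) (P : pred I) (F : I -> 'M[C]_n) :
  (forall i, P i -> psd (F i)) -> psd (\sum_(i <- r | P i) F i).
Proof.
move=> psdF; apply: (big_ind (@psd n)) => //.
  by have := psd_gram (0 : 'M[C]_n); rewrite mulmx0.
move=> A B psdA psdB; split.
  apply/is_hermitianmxP; rewrite expr0 scale1r linearD /= map_mxD.
  by rewrite !psd_adj.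
by move=> v; rewrite mulmxDr mulmxDl mxE addr_ge0 ?psdA.2 ?psdB.2.
Qed.

Lemma invmx_spectralmx n (A : 'M[C]_n) :
  invmx (spectralmx A) = (spectralmx A)^t*.
Proof. by rewrite invmx_unitary ?spectral_unitarymx. Qed.

Lemma fcalcM n f g (A : 'M[C]_n) :
  fcalc f A *m fcalc g A = fcalc (fun x => f x * g x) A.
Proof.
rewrite !fcalcE !mulmxA mulmxK ?spectral_unit //.
rewrite -[_ *m diag_mx _ *m diag_mx _]mulmxA mulmx_diag.
congr (_ *m diag_mx _ *m _).
by apply/rowP => i; rewrite !mxE.
Qed.

Lemma fcalc_id n (A : 'M[C]_n) : psd A -> fcalc id A = A.
Proof.
case=> /hermitian_normalmx /orthomx_spectralP E _; rewrite [RHS]E fcalcE.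
by congr (_ *m diag_mx _ *m _); apply/rowP => i; rewrite !mxE.
Qed.

(** The eigenvalue is the value of the quadratic form of [A] at the corresponding unit
    eigenvector. *)
Lemma psd_spectrum_ge0 n (A : 'M[C]_n) i : psd A -> 0 <= spectral_diag A 0 i.
Proof.
move=> psdA.
have -> : spectral_diag A 0 i =
  (spectralmx A *m A *m (spectralmx A)^t*) i i.
  have /hermitian_normalmx /orthomx_spectralP E := psdA.1.
  rewrite [X in _ *m X *m _]E !mulmxA mulmxV ?spectral_unit //.
  rewrite mul1mx -invmx_spectralmx mulmxK ?spectral_unit //.
  by rewrite !mxE eqxx.
have := psdA.2 ((row i (spectralmx A))^t*).
rewrite trmxCK -row_mul !mxE; congr (0 <= _).
by apply: eq_bigr => j _; rewrite !mxE.
Qed.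

Lemma eq_fcalc n f g (A : 'M[C]_n) : psd A ->
  (forall x, 0 <= x -> f x = g x) -> fcalc f A = fcalc g A.
Proof.
move=> psdA fg; rewrite !fcalcE; congr (_ *m diag_mx _ *m _).
by apply/rowP => i; rewrite !mxE fg // psd_spectrum_ge0.
Qed.

Lemma fcalc_adj n f (A : 'M[C]_n) : psd A ->
  (forall x, 0 <= x -> 0 <= f x) -> (fcalc f A)^t* = fcalc f A.
Proof.
move=> psdA f0; rewrite fcalcE invmx_spectralmx !adjmxM trmxCK mulmxA.
congr (_ *m _ *m _); rewrite tr_diag_mx map_diag_mx; congr diag_mx.
apply/rowP => i; rewrite !mxE; apply: geC0_conj.
by rewrite f0 // psd_spectrum_ge0.
Qed.

Lemma psd_fcalc n f (A : 'M[C]_n) : psd A ->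
  (forall x, 0 <= x -> 0 <= f x) -> psd (fcalc f A).
Proof.
move=> psdA f0; set h := fun x => sqrtC (f x).
have h0 x : 0 <= x -> 0 <= h x by move=> x0; rewrite sqrtC_ge0 f0.
suff -> : fcalc f A = (fcalc h A)^t* *m fcalc h A by apply: psd_gram.
rewrite (fcalc_adj psdA h0) fcalcM; apply: eq_fcalc => // x x0.
by rewrite -expr2 sqrtCK.
Qed.

Lemma psd_psdroot n (A : 'M[C]_n) : psd A -> psd (psdroot A).
Proof. by move=> psdA; apply: psd_fcalc => // x; rewrite sqrtC_ge0. Qed.

Lemma psdrootK n (A : 'M[C]_n) : psd A -> psdroot A *m psdroot A = A.
Proof.
move=> psdA; rewrite /psdroot fcalcM -[RHS]fcalc_id //.
by apply: eq_fcalc => // x _; rewrite -expr2 sqrtCK.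
Qed.

Lemma psd_conj_tr_ge0 m n (A : 'M[C]_n) (Z : 'M[C]_(n, m)) :
  psd A -> 0 <= \tr (Z^t* *m A *m Z).
Proof.
move=> psdA; rewrite -(psdrootK psdA) mulmxA -mulmxA.
by rewrite -{1}(psd_adj (psd_psdroot psdA)) -adjmxM sqfrob_ge0.
Qed.

Lemma psd_tr_ge0 n (A : 'M[C]_n) : psd A -> 0 <= \tr A.
Proof.
by move=> /(psd_conj_tr_ge0 1%:M); rewrite adjmx1 mul1mx mulmx1.
Qed.

Lemma psd_conj_eq0 m n (A : 'M[C]_n) (Z : 'M[C]_(n, m)) :
  psd A -> \tr (Z^t* *m A *m Z) = 0 -> psdroot A *m Z = 0.
Proof.
move=> psdA H; apply: sqfrob_eq0.
rewrite /sqfrob adjmxM (psd_adj (psd_psdroot psdA)) mulmxA.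
by rewrite -[_ *m _ *m psdroot A]mulmxA psdrootK.
Qed.

(* For Z = X - Y with X^2 = Y^2 one has Z X + Y Z = 0, hence
   tr (Z X Z) + tr (Z Y Z) = 0, so both terms vanish and X Z = Y Z = 0. *)
Lemma psdroot_unique n (A X : 'M[C]_n) : psd A -> psd X ->
  X *m X = A -> psdroot A = X.
Proof.
move=> psdA psdX XX; set Y := psdroot A.
have psdY : psd Y := psd_psdroot psdA.
have YY : Y *m Y = A := psdrootK psdA.
pose Z := X - Y.
have Zadj : Z^t* = Z by rewrite adjmxB !psd_adj.
have ZXYZ : Z *m X + Y *m Z = 0.
  by rewrite mulmxBl mulmxBr XX YY addrA subrK subrr.
have : \tr (Z^t* *m X *m Z) + \tr (Z^t* *m Y *m Z) == 0.
  rewrite Zadj [X in X + _]mxtrace_mulC -(mulmxA Z Y) -mxtraceD -mulmxDr.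
  by rewrite ZXYZ mulmx0 mxtrace0.
rewrite paddr_eq0 ?psd_conj_tr_ge0 // => /andP[/eqP X0 /eqP Y0].
have XZ : X *m Z = 0.
  by rewrite -(psdrootK psdX) -mulmxA (psd_conj_eq0 psdX X0) mulmx0.
have YZ : Y *m Z = 0.
  by rewrite -(psdrootK psdY) -mulmxA (psd_conj_eq0 psdY Y0) mulmx0.
apply/esym/eqP; rewrite -subr_eq0; apply/eqP/sqfrob_eq0.
by rewrite /sqfrob -/Z Zadj {1}/Z mulmxBl XZ YZ subrr mxtrace0.
Qed.

(* x / x is 0 at x = 0, so this is the projection onto the support of A. *)
Definition supp n (A : 'M[C]_n) : 'M[C]_n := fcalc (fun x => x / x) A.

Lemma supp_adj n (A : 'M[C]_n) : psd A -> (supp A)^t* = supp A.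
Proof. by move=> psdA; apply: fcalc_adj => // x x0; rewrite divr_ge0. Qed.

Lemma supp_idem n (A : 'M[C]_n) : supp A *m supp A = supp A.
Proof.
rewrite /supp fcalcM !fcalcE; congr (_ *m diag_mx _ *m _); apply/rowP => i.
by rewrite !mxE; have [->|x0] := eqVneq (spectral_diag A 0 i) 0;
  rewrite ?mul0r // divff // mulr1.
Qed.

(** The trace is the squared Frobenius norm of [B (1 - supp A)]. *)
Lemma mul_supp_eq m n (A : 'M[C]_n) (B : 'M[C]_(m, n)) : psd A ->
  \tr ((1%:M - supp A)^t* *m (B^t* *m B) *m (1%:M - supp A)) = 0 ->
  B *m supp A = B.
Proof.
move=> psdA H; apply/esym/eqP; rewrite -subr_eq0 -{1}[B]mulmx1 -mulmxBr.
by apply/eqP/sqfrob_eq0; rewrite /sqfrob adjmxM !mulmxA -[_ *m B^t* *m B]mulmxA.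
Qed.

Lemma mul_psd_suppC n (A : 'M[C]_n) : psd A -> A *m (1%:M - supp A) = 0.
Proof.
move=> psdA; rewrite mulmxBr mulmx1 -{1 2}(fcalc_id psdA) fcalcM.
apply/eqP; rewrite subr_eq0; apply/eqP/eq_fcalc => // x _.
by have [->|x0] := eqVneq x 0; rewrite ?mul0r // divff // mulr1.
Qed.

Lemma mul_supp_gram m n (B : 'M[C]_(m, n)) : B *m supp (B^t* *m B) = B.
Proof.
apply: mul_supp_eq; first exact: psd_gram.
by rewrite -mulmxA mul_psd_suppC ?mulmx0 ?mxtrace0 //; apply: psd_gram.
Qed.

(** Pythagoras: [supp A] is an orthogonal projection, so the two sides differ by the squared norm of
    the complementary part of [Z]. *)
Lemma sqfrob_supp m n (A : 'M[C]_n) (Z : 'M[C]_(n, m)) : psd A ->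
  sqfrob (supp A *m Z) <= sqfrob Z.
Proof.
have E (P : 'M[C]_n) : P^t* = P -> P *m P = P ->
    sqfrob (P *m Z) = \tr (Z^t* *m (P *m Z)).
  by move=> Pa PP; rewrite /sqfrob adjmxM Pa -mulmxA (mulmxA P) PP.
move=> psdA; rewrite -subr_ge0.
have := sqfrob_ge0 ((1%:M - supp A) *m Z); rewrite !E ?supp_adj ?supp_idem //.
- by rewrite mulmxBl mulmxBr mxtraceB mul1mx.
- by rewrite adjmxB adjmx1 supp_adj.
- by rewrite mulmxBl mul1mx mulmxBr mulmx1 supp_idem subrr subr0.
Qed.

Lemma eq_supp n f (A : 'M[C]_n) : psd A -> f 0 = 0 ->
  (forall x, 0 < x -> f x = 1) -> fcalc f A = supp A.
Proof.
move=> psdA f0 f1; apply: eq_fcalc => // x.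
rewrite le_eqVlt => /predU1P[<-|x0]; first by rewrite f0 mul0r.
by rewrite f1 // divff ?gt_eqF.
Qed.

(** * Inverse square roots and fourth roots *)

Definition psdinvroot n (A : 'M[C]_n) := fcalc (fun x => (sqrtC x)^-1) A.

Lemma psdinvroot_adj n (A : 'M[C]_n) : psd A ->
  (psdinvroot A)^t* = psdinvroot A.
Proof.
by move=> psdA; apply: fcalc_adj => // x; rewrite invr_ge0 sqrtC_ge0.
Qed.

Lemma psdroot_adj n (A : 'M[C]_n) : psd A -> (psdroot A)^t* = psdroot A.
Proof. by move=> psdA; apply/psd_adj/psd_psdroot. Qed.

Lemma psdinvrootK n (A : 'M[C]_n) : psd A ->
  psdinvroot A *m A *m psdinvroot A = supp A.
Proof.
move=> psdA; rewrite -{2}(fcalc_id psdA) !fcalcM.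
apply: eq_supp => // [|x x0]; first by rewrite mulr0 mul0r.
by rewrite mulrAC -invfM -expr2 sqrtCK mulVf ?gt_eqF.
Qed.

Lemma psdinvroot_mul n (A : 'M[C]_n) : psd A -> A *m psdinvroot A = psdroot A.
Proof.
move=> psdA; rewrite -{1}(fcalc_id psdA) fcalcM.
apply: eq_fcalc => // x; rewrite le_eqVlt => /predU1P[<-|x0].
  by rewrite mul0r sqrtC0.
by rewrite -{1}[x]sqrtCK expr2 mulfK // sqrtC_eq0 gt_eqF.
Qed.

(** Fourth roots split a trace against [A^(1/2)] or [A^(-1/2)] symmetrically, which turns it into a
    squared Frobenius norm. *)
Definition psdroot4 n (A : 'M[C]_n) := fcalc (fun x => sqrtC (sqrtC x)) A.
Definition psdinvroot4 n (A : 'M[C]_n) :=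
  fcalc (fun x => (sqrtC (sqrtC x))^-1) A.

Lemma psdroot4_adj n (A : 'M[C]_n) : psd A -> (psdroot4 A)^t* = psdroot4 A.
Proof. by move=> psdA; apply: fcalc_adj => // x; rewrite !sqrtC_ge0. Qed.

Lemma psdinvroot4_adj n (A : 'M[C]_n) : psd A ->
  (psdinvroot4 A)^t* = psdinvroot4 A.
Proof.
by move=> psdA; apply: fcalc_adj => // x; rewrite invr_ge0 !sqrtC_ge0.
Qed.

Lemma psdroot4K n (A : 'M[C]_n) : psd A -> psdroot4 A *m psdroot4 A = psdroot A.
Proof.
move=> psdA; rewrite fcalcM; apply: eq_fcalc => // x _.
by rewrite -expr2 sqrtCK.
Qed.

Lemma psdinvroot4K n (A : 'M[C]_n) : psd A ->
  psdinvroot4 A *m psdinvroot4 A = psdinvroot A.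
Proof.
move=> psdA; rewrite fcalcM; apply: eq_fcalc => // x _.
by rewrite -invfM -expr2 sqrtCK.
Qed.

Lemma psdinvroot4_mul n (A : 'M[C]_n) : psd A ->
  psdinvroot4 A *m psdroot4 A = supp A.
Proof.
move=> psdA; rewrite fcalcM; apply: eq_supp => // [|x x0].
  by rewrite !sqrtC0 mulr0.
by rewrite mulVf // !sqrtC_eq0 gt_eqF.
Qed.

Lemma psdroot4_conj n (A : 'M[C]_n) : psd A ->
  psdroot4 A *m A *m psdinvroot4 A = A.
Proof.
move=> psdA; rewrite -{2 4}(fcalc_id psdA) !fcalcM.
apply: eq_fcalc => // x; rewrite le_eqVlt => /predU1P[<-|x0].
  by rewrite mulr0 mul0r.
by rewrite mulrAC divff ?mul1r // !sqrtC_eq0 gt_eqF.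
Qed.

(** * The trace norm and its duality with contractions *)

Definition tnorm n (B : 'M[C]_n) : C := \tr (psdroot (B^t* *m B)).

Lemma tnorm_ge0 n (B : 'M[C]_n) : 0 <= tnorm B.
Proof. exact/psd_tr_ge0/psd_psdroot/psd_gram. Qed.

(** Operator norm at most 1, phrased with Frobenius norms so that it combines directly with
    [sqfrob_amgm]. *)
Definition contraction n (W : 'M[C]_n) :=
  forall Z : 'M[C]_n, sqfrob (W *m Z) <= sqfrob Z.

(* With H = |B|, the polar decomposition B = V H gives
   tr (W B) = <H^(1/2), W V H^(1/2)>, where V H^(1/2) = B H^(-1/2). *)
Lemma tnorm_ge n (W B : 'M[C]_n) : contraction W ->
  \tr (W *m B) + (\tr (W *m B))^*%R <= 2 * tnorm B.
Proof.
move=> Wc; set G := B^t* *m B; have psdG : psd G := psd_gram B.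
pose h := psdroot4 G; pose g := psdinvroot4 G.
have -> : \tr (W *m B) = \tr (h^t* *m (W *m (B *m g))).
  rewrite psdroot4_adj // [RHS]mxtrace_mulC -(mulmxA W) -(mulmxA B).
  by rewrite psdinvroot4_mul // mul_supp_gram.
apply: le_trans (sqfrob_amgm _ _) _.
have -> : tnorm B = sqfrob h by rewrite /sqfrob psdroot4_adj // psdroot4K.
rewrite mulr_natl mulr2n lerD2l; apply: le_trans (Wc _) _.
(* In fact equality: [sqfrob (B g) = tr (g G g) = tr G^(1/2) = sqfrob h]. *)
rewrite le_eqVlt; apply/orP; left; apply/eqP; rewrite /sqfrob adjmxM.
rewrite psdinvroot4_adj // psdroot4_adj // -mulmxA mxtrace_mulC !(mulmxA _ B).
by rewrite -/G -(mulmxA G) psdinvroot4K // psdinvroot_mul // psdroot4K.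
Qed.

(** * The pretty good measurement *)

Section PrettyGoodMeasurement.
Variables (m n : nat) (s : 'I_n -> 'M[C]_m) (i : 'I_n).
Hypothesis psd_s : forall j, psd (s j).
Let S := \sum_j s j.
Let T := psdinvroot S.
Let D := \sum_(j | j != i) s j.
Let a := psdroot (s i).
Let K := a *m T.
Let N := K *m D *m K^t*.

Let psdS : psd S. Proof. exact: psd_sum. Qed.
Let psdD : psd D. Proof. exact: psd_sum. Qed.
Let SE : S = s i + D. Proof. by rewrite /S (bigD1 i). Qed.
Let aa : a *m a = s i. Proof. exact: psdrootK. Qed.
Let a_adj : a^t* = a. Proof. exact: psdroot_adj. Qed.
Let T_adj : T^t* = T. Proof. exact: psdinvroot_adj. Qed.
Let K_adj : K^t* = T *m a. Proof. by rewrite adjmxM a_adj T_adj. Qed.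

Let psdN : psd N.
Proof.
have -> : N = (psdroot D *m K^t*)^t* *m (psdroot D *m K^t*).
  by rewrite adjmxM trmxCK psdroot_adj // mulmxA -(mulmxA K) psdrootK.
exact: psd_gram.
Qed.

(** Compressed to the kernel of [S], the states have nonnegative traces with sum 0, so each trace
    vanishes, that of [s i] included. *)
Let a_supp : a *m supp S = a.
Proof.
apply: mul_supp_eq => //; rewrite a_adj aa.
set Q := 1%:M - supp S.
have Q_ge0 j : true -> 0 <= \tr (Q^t* *m s j *m Q).
  by move=> _; apply: psd_conj_tr_ge0.
have : \sum_j \tr (Q^t* *m s j *m Q) = 0.
  rewrite -raddf_sum -mulmx_suml -mulmx_sumr -/S -mulmxA mul_psd_suppC //.
  by rewrite mulmx0 /= mxtrace0.
by move=> /(psumr_eq0P Q_ge0); apply.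
Qed.

(** With [D = S - s i], the [S] part is [a (T S T) a], where [T S T = supp S] fixes [a]; the [s i]
    part is the success term. *)
Let trN : \tr N = \tr (s i) - \tr (T *m s i *m T *m s i).
Proof.
rewrite /N; have -> : D = S - s i by rewrite SE addrC addKr.
rewrite mulmxBr mulmxBl mxtraceB K_adj; congr (_ - _).
  have -> : K *m S *m (T *m a) = a *m (T *m S *m T) *m a by rewrite !mulmxA.
  by rewrite psdinvrootK // a_supp aa.
by rewrite mulmxA mxtrace_mulC [RHS]mxtrace_mulC /K !mulmxA aa.
Qed.

(* The block of index j of the polar part Y' (Y Y')^(-1/2). *)
Let W j := psdroot (s j) *m K^t* *m psdinvroot N.

(** The sum of [(W l)^t* W l] over [l != i] is [N^(-1/2) N N^(-1/2) = supp N], a projection, and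
    each summand is nonnegative. *)
Let W_contraction j : j != i -> contraction (W j).
Proof.
move=> ji Z; apply: le_trans (sqfrob_supp Z psdN).
have E l : sqfrob (W l *m Z) =
    \tr (Z^t* *m (psdinvroot N *m (K *m s l *m K^t*) *m psdinvroot N) *m Z).
  rewrite /sqfrob /W !adjmxM trmxCK psdroot_adj ?psdinvroot_adj //.
  by rewrite -[in RHS](psdrootK (psd_s l)) !mulmxA.
have -> : sqfrob (supp N *m Z) = \sum_(l | l != i) sqfrob (W l *m Z).
  under eq_bigr do rewrite E.
  rewrite -raddf_sum -mulmx_suml -mulmx_sumr -mulmx_suml -mulmx_sumr.
  rewrite -mulmx_suml -mulmx_sumr -/D -/N psdinvrootK // /sqfrob adjmxM.
  by rewrite supp_adj // !mulmxA -(mulmxA _ (supp N) (supp N)) supp_idem.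
rewrite (bigD1 j) //= lerDl; apply: sumr_ge0 => l _; exact: sqfrob_ge0.
Qed.

(* tr (X N^(1/2)) = sqfrob p and tr (N^(-1/2) Y Z Y') = sqfrob q, while
   p^t* q has the trace of N. *)
Let p := psdinvroot4 S *m a *m psdroot4 N.
Let q := psdinvroot4 S *m D *m K^t* *m psdinvroot4 N.

Let sum_trW :
  \sum_(j | j != i) \tr (W j *m (a *m psdroot (s j))) = sqfrob p + sqfrob q.
Proof.
have -> : \sum_(j | j != i) \tr (W j *m (a *m psdroot (s j))) =
    \tr (psdinvroot N *m (a *m D) *m K^t*).
  rewrite mulmx_sumr mulmx_sumr mulmx_suml raddf_sum; apply: eq_bigr => j _.
  rewrite /W mxtrace_mulC !mulmxA -(mulmxA a (psdroot _)) psdrootK //.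
  by rewrite [LHS]mxtrace_mulC !mulmxA.
(* This is [X Y + Y Z], with block [j] multiplied by [psdroot (s j)] and summed over [j != i]:
   insert [supp S = T S T] after [a] and split the inner [S] as [s i + D]. *)
have -> : a *m D = K *m s i *m T *m D + K *m D *m T *m D.
  rewrite -mulmxDl -mulmxDl -mulmxDr -SE -{1}a_supp -psdinvrootK //.
  by rewrite !mulmxA.
rewrite mulmxDr mulmxDl mxtraceD; congr (_ + _).
  have -> : psdinvroot N *m (K *m s i *m T *m D) *m K^t* =
      psdinvroot N *m (K *m a) *m N.
    by rewrite -aa /N /K !mulmxA.
  rewrite mxtrace_mulC (mulmxA N (psdinvroot N)) psdinvroot_mul //.
  transitivity (\tr (psdroot4 N *m (K *m a *m psdroot4 N))).
    rewrite [RHS]mxtrace_mulC -(mulmxA _ (psdroot4 N)) psdroot4K //.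
    by rewrite [RHS]mxtrace_mulC.
  rewrite /sqfrob /p !adjmxM psdinvroot4_adj // psdroot4_adj // a_adj.
  by rewrite /K /T -(psdinvroot4K psdS) !mulmxA.
pose g := psdinvroot4 N.
transitivity (\tr (g *m (K *m D *m T *m D *m K^t* *m g))).
  rewrite [RHS]mxtrace_mulC -(mulmxA _ g) psdinvroot4K // [RHS]mxtrace_mulC.
  by rewrite !mulmxA.
rewrite /sqfrob /q K_adj !adjmxM T_adj a_adj !psdinvroot4_adj // (psd_adj psdD).
by rewrite /K /T -(psdinvroot4K psdS) !mulmxA.
Qed.

(** The trace of [p^t* q] is the real number [tr N], so the two cross terms of [sqfrob (p - q)] add
    up to [2 tr N]. *)
Let trN_le : 2 * \tr N <= sqfrob p + sqfrob q.
Proof.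
have := sqfrob_amgm p q.
have -> : p^t* *m q = psdroot4 N *m N *m psdinvroot4 N.
  transitivity (psdroot4 N *m (a *m T *m D *m (T *m a)) *m psdinvroot4 N).
    rewrite /p /q K_adj !adjmxM psdinvroot4_adj // psdroot4_adj // a_adj.
    by rewrite /T -(psdinvroot4K psdS) !mulmxA.
  by congr (_ *m _ *m _); rewrite /N K_adj.
by rewrite psdroot4_conj // geC0_conj ?psd_tr_ge0 // mulr_natl mulr2n.
Qed.

Lemma pgm_error_le :
  2 * (\tr (s i) - \tr (T *m s i *m T *m s i))
    <= \sum_(j | j != i) tnorm (a *m psdroot (s j)).
Proof.
rewrite -trN; apply: le_trans trN_le _.
rewrite -(ler_pM2l (ltr0n C 2)) mulr_sumr.
(* The sum is real, hence twice it is the sum plus its conjugate, and [tnorm_ge] bounds this term by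
   term. *)
have /geC0_conj E : 0 <= sqfrob p + sqfrob q by rewrite addr_ge0 ?sqfrob_ge0.
rewrite mulr_natl mulr2n -{2}E -sum_trW rmorph_sum -big_split /=.
by apply: ler_sum => j ji; apply/tnorm_ge/W_contraction.
Qed.

End PrettyGoodMeasurement.

End PositiveMatrices.

(** * Tensor powers *)

Lemma mxtrace_tens (A : comPzRingType) m n (M : 'M[A]_m) (N : 'M[A]_n) :
  \tr (mxtens.tensmx M N) = \tr M * \tr N.
Proof.
by rewrite /mxtrace mxtens.mulr_sum; apply: eq_bigr => i _; rewrite !mxE.
Qed.

Lemma mxtrace_ntens (A : comPzRingType) n (M : 'M[A]_n) k :
  \tr (mxtens.ntensmx M k) = (\tr M) ^+ k.
Proof.
case: k => [|k]; first by rewrite mxtens.ntensmx0 expr0 mxtrace1.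
(* The induction starts at exponent 1, where the tensor power is the matrix itself. *)
elim: k => [//|k IH].
by rewrite mxtens.ntensmxSS mxtrace_tens IH -exprS.
Qed.

Lemma ntensmx_mul (A : comPzRingType) m n p
    (M : 'M[A]_(m, n)) (N : 'M[A]_(n, p)) k :
  mxtens.ntensmx (M *m N) k = mxtens.ntensmx M k *m mxtens.ntensmx N k.
Proof.
case: k => [|k]; first by rewrite !mxtens.ntensmx0 mulmx1.
elim: k => [//|k IH].
by rewrite !mxtens.ntensmxSS IH mxtens.tensmx_mul.
Qed.

Section TensorPowers.
Variable C : numClosedFieldType.

Lemma adjmx_ntens m n (M : 'M[C]_(m, n)) k :
  (mxtens.ntensmx M k)^t* = mxtens.ntensmx (M^t*) k.
Proof.
case: k => [|k]; first by rewrite !mxtens.ntensmx0 [LHS]adjmx1.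
elim: k => [//|k IH].
by rewrite !mxtens.ntensmxSS mxtens.trmx_tens mxtens.map_mxT IH.
Qed.

Lemma psd_ntens n (A : 'M[C]_n) k : psd A -> psd (mxtens.ntensmx A k).
Proof.
move=> psdA; rewrite -(psdrootK psdA) -{1}(psdroot_adj psdA).
by rewrite ntensmx_mul -adjmx_ntens; apply: psd_gram.
Qed.

(** The power of the root is positive semidefinite with the right square, so uniqueness of the root
    applies. Multiplicativity of the fidelity follows from this. *)
Lemma psdroot_ntens n (A : 'M[C]_n) k : psd A ->
  psdroot (mxtens.ntensmx A k) = mxtens.ntensmx (psdroot A) k.
Proof.
move=> psdA; apply: psdroot_unique; rewrite -?ntensmx_mul ?psdrootK //.
  exact: psd_ntens.
exact/psd_ntens/psd_psdroot.
Qed.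

Lemma tnorm_ntens n (B : 'M[C]_n) k : tnorm (mxtens.ntensmx B k) = tnorm B ^+ k.
Proof.
rewrite /tnorm adjmx_ntens -ntensmx_mul psdroot_ntens ?mxtrace_ntens //.
exact: psd_gram.
Qed.

End TensorPowers.

Local Open Scope complex_scope.

(** * Fidelity and failure probability as real numbers *)

Section Bridge.
Variable R : realType.
Local Notation C := R[i].

Lemma mxfunE n f (A : 'M[C]_n) : mxfun f A = fcalc f A.
Proof. by rewrite fcalcE. Qed.

Lemma trace_normE n (B : 'M[C]_n) : trace_norm B = complex.Re (tnorm B).
Proof. by rewrite /trace_norm /sqrtmx mxfunE. Qed.

Lemma fidelityE n (A B : 'M[C]_n) :
  fidelity A B = complex.Re (tnorm (psdroot A *m psdroot B)).
Proof. by rewrite /fidelity trace_normE /sqrtmx !mxfunE. Qed.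

Lemma ReD (x y : C) : complex.Re (x + y) = complex.Re x + complex.Re y.
Proof. by case: x y => [a b] [c d]. Qed.

Lemma ReX (x : C) k : 0 <= x -> complex.Re (x ^+ k) = complex.Re x ^+ k.
Proof. by move=> /ger0_real /RRe_real <-; rewrite -rmorphXn. Qed.

Lemma fidelity_ge0 n (A B : 'M[C]_n) : 0 <= fidelity A B.
Proof.
rewrite fidelityE; have := tnorm_ge0 (psdroot A *m psdroot B).
by rewrite lecE => /andP[].
Qed.

Lemma fidelity_tensor_power n (A B : 'M[C]_n) k : psdmx A -> psdmx B ->
  fidelity (tensor_power A k) (tensor_power B k) = fidelity A B ^+ k.
Proof.
move=> psdA psdB; rewrite !fidelityE /tensor_power !psdroot_ntens //.
by rewrite -ntensmx_mul tnorm_ntens ReX // tnorm_ge0.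
Qed.

Lemma pgm_failure_le m n (s : 'I_n -> 'M[C]_m) (i : 'I_n) :
  (forall j, mixed_state (s j)) ->
  1 - outcome_prob (pgm s i) (s i) <= \sum_(j | j != i) fidelity (s i) (s j).
Proof.
move=> st; have psds j : psd (s j) := (st j).1.
have := pgm_error_le i psds; rewrite (st i).2.
rewrite lecE => /andP[_].
have -> : complex.Re
      (\sum_(j | j != i) tnorm (psdroot (s i) *m psdroot (s j))) =
    \sum_(j | j != i) fidelity (s i) (s j).
  rewrite (big_morph _ ReD (erefl _)).
  by apply: eq_bigr => j _; rewrite fidelityE.
rewrite /outcome_prob /pgm /invsqrtmx mxfunE -/(psdinvroot _).
case: (\tr _) => a b; rewrite mulr_natl mulr2n ReD /= => le2.
(* Here [a] is the success probability. The factor 1/2 is given up: [1 - a] is at most its double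
   when nonnegative, and otherwise lies below a sum of fidelities. *)
have [a1|a1] := leP 0 (1 - a); first by apply: le_trans le2; rewrite lerDl.
by apply: le_trans (ltW a1) _; apply: sumr_ge0 => j _; apply: fidelity_ge0.
Qed.

Lemma mixed_state_tensor_power n (A : 'M[C]_n) k :
  mixed_state A -> mixed_state (tensor_power A k).
Proof.
case=> psdA trA; split; first exact: psd_ntens.
by rewrite /tensor_power mxtrace_ntens trA expr1n.
Qed.

End Bridge.

(** From [1 - eps <= exp (- eps)] and [eps k >= ln (n / delta)] one gets
    [(1 - eps)^k <= delta / n]. *)
Lemma expr_1subx_ceil_le (R : realType) (n : nat) (eps delta : R) :
  (0 < n)%N -> 0 < eps <= 1 -> 0 < delta ->
  n%:R * (1 - eps) ^+ `|Num.ceil (ln (n%:R / delta) / eps)|%N <= delta.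
Proof.
move=> n0 /andP[eps0 eps1] delta0; set L := ln _; set k := `|_|%N.
(* Taking the absolute value can only increase the ceiling, so the bound holds for either sign of
   [L]. *)
have kL : L <= eps * k%:R.
  rewrite mulrC -ler_pdivrMr // natr_absz (le_trans (ceil_ge _)) //.
  by rewrite intr_norm ler_norm.
have ndelta : 0 < n%:R / delta by rewrite divr_gt0 ?ltr0n.
have : (1 - eps) ^+ k <= expR (- L).
  apply: (@le_trans _ _ (expR (- eps) ^+ k)).
    by rewrite lerXn2r ?nnegrE ?subr_ge0 ?expR_ge0 ?expR_ge1Dx.
  by rewrite -expRM_natl ler_expR mulrN lerN2 mulrC.
rewrite expRN lnK ?posrE // invf_div ler_pdivlMr ?ltr0n // mulrC; exact.
Qed.

Theorem theorem1 (R : realType) :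
  exists C : R, 0 < C /\
    forall (d n : nat) (eps delta : R) (rho : 'I_n -> 'M[R[i]]_d),
      (1 <= d)%N -> (1 <= n)%N ->
      0 < eps <= 1 -> 0 < delta < 1 ->
      injective rho ->
      (forall i : 'I_n, mixed_state (rho i)) ->
      (forall i j : 'I_n, i != j -> fidelity (rho i) (rho j) <= 1 - eps) ->
      let k := `|Num.ceil (C * ln (n%:R / delta) / eps)|%N in
      let sigma := fun i : 'I_n => tensor_power (rho i) k in
      worst_case_failure (pgm sigma) sigma <= delta.
Proof.
exists 1; split=> // d n eps delta rho _ n1 eps01 /andP[delta0 _] _ st fid.
rewrite mul1r; cbv zeta; set k := `|_|%N; set sigma := fun i => _.
(* The default value 0 of the maximum must also be at most [delta]. *)
apply: bigmax_le => [|i _]; first exact: ltW.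
have stk j : mixed_state (sigma j) by apply: mixed_state_tensor_power.
apply: le_trans (pgm_failure_le i stk) _.
apply: le_trans (expr_1subx_ceil_le n1 eps01 delta0).
have e0 : 0 <= 1 - eps by case/andP: eps01 => _; rewrite subr_ge0.
(* Adding the nonnegative term for [j = i] makes the number of terms exactly [n]. *)
apply: (@le_trans _ _ (\sum_(j < n) (1 - eps) ^+ k)); last first.
  by rewrite sumr_const card_ord mulr_natl.
rewrite [leRHS](bigD1 i) //= ler_wpDl ?exprn_ge0 //; apply: ler_sum => j ji.
rewrite (fidelity_tensor_power _ (st i).1 (st j).1).
by rewrite lerXn2r ?nnegrE ?fidelity_ge0 // fid // eq_sym.
Qed.
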